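(* Let $\{\xi_1,\xi_2,\ldots\}$ be independent nonnegative random variables with distribution functions $\{F_{\xi_1},F_{\xi_2},\ldots\}$, and let $\eta$ be a counting random variable independent of $\{\xi_1,\xi_2,\ldots\}$. Let $S_\eta=\sum_{k=1}^{\eta}\xi_k$ be the random sum. Suppose that there is some $\kappa\in\operatorname{supp}(\eta)\setminus\{0\}$ such that the following three conditions are satisfied: (1) $F_{\xi_\kappa}\in\mathcal{OL}$; (2) for each $k\in\operatorname{supp}(\eta)$ with $1\leqslant k\leqslant\kappa$, either $\lim_{x\to\infty}\frac{\overline{F}_{\xi_k}(x)}{\overline{F}_{\xi_\kappa}(x)}=0$ or $F_{\xi_k}\in\mathcal{OL}$; (3) $\sup_{x\geqslant 0}\,\sup_{k\geqslant 1}\frac{\overline{F}_{\xi_{\kappa+k}}(x-1)}{\overline{F}_{\xi_{\kappa+k}}(x)}<\infty$. Then the distribution function $F_{S_\eta}$ of $S_\eta$ belongs to $\mathcal{OL}$.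
   Context: For a random variable $X$, $F_X(x)=\mathbb{P}(X\leqslant x)$ is its distribution function; for a distribution function $F$, $\overline{F}(x)=1-F(x)$, $x\in\mathbb{R}$, is its tail. A distribution function $F$ belongs to the class $\mathcal{OL}$ of $\mathcal{O}$-exponential distributions if for all $a\in\mathbb{R}$ $$0<\liminf_{x\to\infty}\frac{\overline{F}(x+a)}{\overline{F}(x)}\leqslant\limsup_{x\to\infty}\frac{\overline{F}(x+a)}{\overline{F}(x)}<\infty$$ (in particular, $\overline{F}(x)>0$ for all $x\in\mathbb{R}$). A counting random variable is an integer-valued, nonnegative random variable that is nondegenerate at zero (i.e. not almost surely equal to $0$). $\operatorname{supp}(\eta)=\{n\in\{0,1,2,\ldots\}:\mathbb{P}(\eta=n)>0\}$, so $\operatorname{supp}(\eta)\setminus\{0\}=\{n\in\mathbb{N}:\mathbb{P}(\eta=n)>0\}$ with $\mathbb{N}=\{1,2,\ldots\}$. Partial sums: $S_0=0$, $S_n=\xi_1+\cdots+\xi_n$ for $n\in\mathbb{N}$; $S_\eta=\sum_{k=1}^{\eta}\xi_k$ is the random sum, with distribution function $F_{S_\eta}(x)=\sum_{n=0}^\infty\mathbb{P}(\eta=n)\mathbb{P}(S_n\leqslant x)$. *)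

(* Defs.v *)
From HB Require Import structures.
From mathcomp Require Import all_boot all_order all_algebra finmap.
From mathcomp Require Import all_classical all_reals all_analysis.

Set Implicit Arguments.
Unset Strict Implicit.
Unset Printing Implicit Defensive.

Import Order.TTheory GRing.Theory Num.Theory.
Import numFieldNormedType.Exports.

Local Open Scope classical_set_scope.
Local Open Scope ring_scope.
Local Open Scope ereal_scope.

Section tails.
Context {R : realType}.
Implicit Types (F : R -> \bar R).

Definition tail F : R -> \bar R := fun x => 1 - F x.

(* Quotients of tails are taken in \bar R, where 0^-1 = +oo; so c / 0 = +oo for
   c > 0, while 0 / 0 = 0.  In particular, if the tail of F vanishes from some
   point on, then the lower limit below is 0 and F is not in OL. *)
Definition OL F : Prop := forall a : R,
  let q := fun x : R => tail F (x + a)%R / tail F x in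
  [/\ 0 < limf_einf q +oo%R,
      limf_einf q +oo%R <= limf_esup q +oo%R &
      limf_esup q +oo%R < +oo].

End tails.

Section independence.
Context {d d' d'' : measure_display} {T : measurableType d} {R : realType}
  (P : probability T R).

Definition mutually_independent {I : choiceType} {T' : measurableType d'}
    (D : set I) (X : I -> {RV P >-> T'}) : Prop :=
  forall (J : {fset I}) (B : I -> set T'),
    [set` J] `<=` D -> (forall i, measurable (B i)) ->
    P (\bigcap_(i in [set` J]) X i @^-1` B i) =
      \prod_(i <- J) P (X i @^-1` B i).

(* The sigma-algebra generated by the X i, i in D. *)
Definition sigma_family {I : Type} {T' : measurableType d'}
    (D : set I) (X : I -> {RV P >-> T'}) : set (set T) :=
  <<s \bigcup_(i in D) [set X i @^-1` B | B in measurable] >>.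

Definition independent_of_family {I : Type} {T' : measurableType d'}
    {T'' : measurableType d''}
    (Y : {RV P >-> T''}) (D : set I) (X : I -> {RV P >-> T'}) : Prop :=
  forall (A : set T'') (E : set T), measurable A -> sigma_family D X E ->
    P (Y @^-1` A `&` E) = P (Y @^-1` A) * P E.

End independence.

Section counting.
Context {d : measure_display} {T : measurableType d} {R : realType}
  (P : probability T R).

Definition supp (eta : {RV P >-> nat}) : set nat :=
  [set n | 0 < P (eta @^-1` [set n])].

(* Nondegeneracy at zero; being a nonnegative integer is built into the type nat. *)
Definition counting_rv (eta : {RV P >-> nat}) : Prop :=
  P (eta @^-1` [set 0%N]) != 1.

End counting.

Section random_sum.
Context {d : measure_display} {T : measurableType d} {R : realType}.
Variables (xi : nat -> {mfun T >-> R}) (eta : {mfun T >-> nat}).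

Definition random_sum : T -> R :=
  fun w => (\sum_(1 <= k < (eta w).+1) xi k w)%R.

Let measurable_random_sum : measurable_fun [set: T] random_sum.
Proof.
move=> _ B mB; rewrite setTI.
have -> : random_sum @^-1` B = \bigcup_n (eta @^-1` [set n] `&`
    (fun w => (\sum_(1 <= k < n.+1) xi k w)%R) @^-1` B).
  apply/seteqP; split=> [w Bw|w [n _ [/= <-]]] //.
  by exists (eta w).
apply: bigcupT_measurable => n; apply: measurableI.
  by rewrite -[X in measurable X]setTI; exact: measurable_funPT.
rewrite -[X in measurable X]setTI.
by apply: measurable_sum.
Qed.

HB.instance Definition _ :=
  isMeasurableFun.Build _ _ _ _ random_sum measurable_random_sum.

End random_sum.

(* Main.v *)
(** Membership in OL amounts to positivity of the tail together with a uniform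
    bound  tail x <= c * tail (x + 1).  If xi_kappa satisfies this bound, then so
    does S_n for every n >= kappa with the same c: condition on the other,
    independent, summands.  On {eta >= kappa} the bound for S_eta follows by
    summing over eta.  On {eta < kappa} nonnegativity gives S_eta <= S_kappa, and
      P(S_kappa > x) <= c P(S_kappa > x + 1) <= c P(S_eta > x + 1) / P(eta = kappa). *)
Require Import Defs.
From HB Require Import structures.
From mathcomp Require Import all_boot all_order all_algebra finmap.
From mathcomp Require Import all_classical all_reals all_analysis.
From mathcomp Require Import measurable_realfun.

Import Order.TTheory GRing.Theory Num.Theory.
Import numFieldNormedType.Exports.

Local Open Scope classical_set_scope.
Local Open Scope ring_scope.
Local Open Scope ereal_scope.

(** Two members of a proper filter always meet, and the value at a common point separates the
    infimum over one from the supremum over the other. *)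
Lemma limf_einf_le_esup (T : choiceType) (X : filteredType T) (R : realType)
    (f : X -> \bar R) (F : set (set X)) : ProperFilter F ->
  limf_einf f F <= limf_esup f F.
Proof.
move=> FF; rewrite limf_einfE limf_esupE.
apply: ge_ereal_sup => _ [V FV <-]; apply: le_ereal_inf_tmp => _ [W FW <-].
have [x [Vx Wx]] : V `&` W !=set0 by exact: (filter_ex (filterI FV FW)).
apply: (@le_trans _ _ (f x)); first by apply: ereal_inf_lbound; exists x.
by apply: ereal_sup_ubound; exists x.
Qed.

(** * Tails controlled by their unit shift *)

Section tail_shift.
Context (d : measure_display) (T : measurableType d) (R : realType)
  (P : probability T R).
Implicit Types X Y : {RV P >-> R}.

Lemma ccdfE X x : ccdf X x = P [set w | (x < X w)%R].
Proof.
by rewrite /ccdf /distribution/= /pushforward; congr (P _); apply/seteqP; split => w /=;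
  rewrite in_itv/= andbT.
Qed.

Lemma tail_cdf X : tail (cdf X) = ccdf X.
Proof. by apply/funext => x; rewrite ccdf_1_cdf. Qed.

(** The positive lower limit at shift 1 gives the bound beyond some [M]. Up to [M], the tail is at
    most 1 and its shift is bounded below by a positive value. *)
Lemma OL_ccdf_shift X : OL (cdf X) ->
  exists c : R, [/\ (0 < c)%R, forall x, 0 < ccdf X x &
    forall x, ccdf X x <= c%:E * ccdf X (x + 1)%R].
Proof.
move=> /(_ 1%R); rewrite /= tail_cdf => -[+ _ _].
have ccdf_fin x : ccdf X x \is a fin_num by exact: fin_num_measure.
rewrite limf_einfE => /ereal_sup_gt[_ [V [M [_ MV]] <-]] inf_gt0.
set I := ereal_inf _ in inf_gt0.
(* Truncation at 1 makes the infimum a real number. *)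
pose r := fine (mine I 1).
have minI_gt0 : 0 < mine I 1 by rewrite lt_min inf_gt0 lte01.
have minI_fin : mine I 1 \is a fin_num.
  by rewrite ge0_fin_numE ?ltW// gt_min ltry orbT.
have r_gt0 : (0 < r)%R by rewrite -lte_fin fineK.
have quot_ge x : (M < x)%R -> r%:E <= ccdf X (x + 1)%R / ccdf X x.
  move=> Mx; rewrite fineK// ge_min; apply/orP; left.
  by apply: ereal_inf_lbound; exists x => //; exact: MV.
have ccdf_anti x y : (x <= y)%R -> ccdf X y <= ccdf X x.
  exact: ccdf_nonincreasing.
have ccdf_gt0M x : (M < x)%R -> 0 < ccdf X x.
  (* If the tail vanished at [x], it would also vanish at [x + 1], and the quotient 0 / 0 = 0 would
     fall below [r]. *)
  move=> Mx; rewrite lt0e measure_ge0 andbT; apply/eqP => X0.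
  have := quot_ge _ Mx.
  have -> : ccdf X (x + 1)%R = 0.
    by apply/eqP; rewrite eq_le measure_ge0 andbT -X0 ccdf_anti// lerDl.
  by rewrite mul0e lee_fin leNgt r_gt0.
have ccdf_gt0 x : 0 < ccdf X x.
  apply: (lt_le_trans (ccdf_gt0M (Num.max x M + 1)%R _)).
    by rewrite ltr_pwDr// le_max lexx orbT.
  by apply: ccdf_anti; rewrite ler_wpDr// le_max lexx.
(* For [x <= M] the point [x + 1] lies to the left of [M + 2], so [k] bounds the shifted tail from
   below. *)
pose k := fine (ccdf X (M + 2)%R).
have k_gt0 : (0 < k)%R by rewrite -lte_fin fineK.
exists (r^-1 + k^-1)%R; split => //; first by rewrite addr_gt0 ?invr_gt0.
move=> x; have [Mx|xM] := ltP M x.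
  apply: (@le_trans _ _ (r^-1%:E * ccdf X (x + 1)%R)).
    rewrite lee_pdivlMl//.
    have := quot_ge x Mx; have := ccdf_gt0 x.
    rewrite -(fineK (ccdf_fin x)) lte_fin => Xx_gt0.
    by rewrite inver gt_eqF// lee_pdivlMr.
  by rewrite lee_pmul2r// lee_fin lerDl invr_ge0 ltW.
apply: (@le_trans _ _ 1); first exact: probability_le1.
apply: (@le_trans _ _ (k^-1%:E * ccdf X (x + 1)%R)).
  rewrite lee_pdivlMl// mule1 fineK// ccdf_anti//.
  by rewrite (_ : 2 = 1 + 1)%R// addrA lerD2r ler_wpDr.
by rewrite lee_pmul2r// lee_fin lerDr invr_ge0 ltW.
Qed.

(** Iterating the bound [n] times with [n >= |a|] and using monotonicity keeps the quotient between
    [c ^- n] and [c ^+ n] on the whole line. The upper bound comes from iterating from [x + a],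
    since [x <= x + a + n]. *)
Lemma ccdf_shift_OL X (c : R) : (0 < c)%R -> (forall x, 0 < ccdf X x) ->
    (forall x, ccdf X x <= c%:E * ccdf X (x + 1)%R) ->
  OL (cdf X).
Proof.
move=> c_gt0 ccdf_gt0 ccdf_shift a /=; rewrite tail_cdf.
have ccdf_fin x : ccdf X x \is a fin_num by exact: fin_num_measure.
have ccdf_shiftn n x : ccdf X x <= (c ^+ n)%:E * ccdf X (x + n%:R)%R.
  elim: n => [|n IHn] in x *; first by rewrite expr0 mul1e addr0.
  apply: (le_trans (IHn x)); rewrite exprSr EFinM -muleA lee_pmul2l//.
    by rewrite -natr1 addrA.
  by rewrite lte_fin exprn_gt0.
have ccdf_anti x y : (x <= y)%R -> ccdf X y <= ccdf X x.
  exact: ccdf_nonincreasing.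
pose n := (Num.truncn `|a|).+1.
have an : (`|a| <= n%:R)%R by apply/ltW/truncnS_gt.
pose C := (c ^+ n)%R.
have C_gt0 : (0 < C)%R by rewrite exprn_gt0.
have quot_ge x : C^-1%:E <= ccdf X (x + a)%R / ccdf X x.
  have := ccdf_gt0 x; rewrite -(fineK (ccdf_fin x)) lte_fin => Xx_gt0.
  rewrite inver gt_eqF// lee_pdivlMr// lee_pdivrMl// fineK//.
  apply: (le_trans (ccdf_shiftn n x)); rewrite lee_pmul2l// ccdf_anti// lerD2l.
  exact: le_trans (ler_norm _) an.
have quot_le x : ccdf X (x + a)%R / ccdf X x <= C%:E.
  have := ccdf_gt0 x; rewrite -(fineK (ccdf_fin x)) lte_fin => Xx_gt0.
  rewrite inver gt_eqF// lee_pdivrMr// fineK//.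
  apply: (le_trans (ccdf_shiftn n _)); rewrite lee_pmul2l// ccdf_anti//.
  by rewrite -addrA lerDl addrC -lerBlDr sub0r; apply: le_trans an; rewrite -normrN ler_norm.
split; last 1 first.
- apply: (@le_lt_trans _ _ C%:E); last exact: ltry.
  rewrite limf_esupE; apply: ereal_inf_le => /=.
  exists (ereal_sup ((fun x => ccdf X (x + a)%R / ccdf X x) @` setT)).
    by exists setT => //; exact: filterT.
  by apply: ge_ereal_sup => _ [x _ <-].
- apply: (@lt_le_trans _ _ C^-1%:E); first by rewrite lte_fin invr_gt0.
  rewrite limf_einfE; apply: le_ereal_sup_tmp => /=.
  exists (ereal_inf ((fun x => ccdf X (x + a)%R / ccdf X x) @` setT)).
    by exists setT => //; exact: filterT.
  by apply: le_ereal_inf_tmp => _ [x _ <-].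
- exact: limf_einf_le_esup.
Qed.

(** Conditionally on [Y = y] the tail of the sum is that of [X] at [x - y], so the bound for [X]
    integrates against the law of [Y] with the same [c]. *)
Lemma indep_add_ccdf_shift X Y (c : R) : (0 <= c)%R ->
    (forall A B, measurable A -> measurable B ->
      P (Y @^-1` A `&` X @^-1` B) = P (Y @^-1` A) * P (X @^-1` B)) ->
    (forall x, ccdf X x <= c%:E * ccdf X (x + 1)%R) ->
  forall x, P [set w | (x < Y w + X w)%R] <=
    c%:E * P [set w | (x + 1 < Y w + X w)%R].
Proof.
move=> c_ge0 indepXY X_shift.
have mYX : measurable_fun setT (fun w => (Y w, X w)).
  by apply/measurable_fun_pair; exact: measurable_funPT.
pose H x := [set p : R * R | (x < p.1 + p.2)%R].
have mH x : measurable (H x).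
  have : measurable_fun setT (fun p : R * R => p.1 + p.2)%R.
    by apply: measurable_funD; [exact: measurable_fst|exact: measurable_snd].
  move=> /(_ measurableT `]x, +oo[%classic (measurable_itv _)).
  rewrite setTI; congr measurable.
  by apply/seteqP; split => p /=; rewrite in_itv/= andbT.
have HE x : P [set w | (x < Y w + X w)%R] =
    \int[distribution P Y]_y ccdf X (x - y)%R.
  transitivity ((distribution P Y \x distribution P X) (H x)).
    (* Independence says that the law of [(Y, X)] agrees with the product measure on rectangles,
       hence everywhere. *)
    by rewrite (product_measure_unique (m' := pushforward P (fun w => (Y w, X w)))).
  apply: eq_integral => y _ /=; congr (distribution P X _).
  apply/seteqP; split => z; rewrite /xsection/= inE /H/= in_itv/= andbT ltrBlDl//.
have mccdf x : measurable_fun setT (fun y : R => ccdf X (x - y)%R).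
  apply: (measurableT_comp (ccdf_measurable X)).
  exact: measurable_funB.
move=> x; rewrite !HE -ge0_integralZl//.
apply: ge0_le_integral => //.
- exact: measurable_funeM.
- by move=> y _; rewrite addrAC.
Qed.

End tail_shift.

(** * Sums and generated sigma-algebras *)

(** This is measurability of finite sums on [T] equipped with the coarser sigma-algebra
    [<<s G >>]. *)
Lemma sigma_preimage_sum (d : measure_display) (T : measurableType d)
    (R : realType) (I : eqType) (G : set (set T)) (h : I -> T -> R) (s : seq I) :
  (forall i, i \in s -> forall B, measurable B -> <<s G >> (h i @^-1` B)) ->
  forall B, measurable B -> <<s G >> ((fun w => \sum_(i <- s) h i w)%R @^-1` B).
Proof.
(* Terms outside [s] are replaced by 0 because [measurable_sum] asks for measurability at every
   index. *)
move=> mh; pose h' i : g_sigma_algebraType G -> R := if i \in s then h i else cst 0%R.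
have mh' i : measurable_fun setT (h' i).
  rewrite /h'; case: ifPn => [si|_]; last exact: measurable_cst.
  by move=> _ B mB; rewrite setTI; exact: mh.
move=> B mB; have := measurable_sum s mh' measurableT mB; rewrite setTI.
congr (<<s G >> (_ @^-1` B)); apply/funext => w.
by apply: eq_big_seq => i si; rewrite /h' si.
Qed.

Lemma mutually_independent_sum (d : measure_display) (T : measurableType d)
    (R : realType) (P : probability T R) (I : choiceType) (D : set I)
    (X : I -> {RV P >-> R}) (i : I) (J : {fset I}) :
    mutually_independent D X -> i \notin J -> [set` (i |` J)%fset] `<=` D ->
  forall A B, measurable A -> measurable B ->
  P ((fun w => \sum_(j <- J) X j w)%R @^-1` A `&` X i @^-1` B) =
    P ((fun w => \sum_(j <- J) X j w)%R @^-1` A) * P (X i @^-1` B).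
Proof.
move=> indepX iNJ iJD A B mA mB.
have mX j C : measurable C -> measurable (X j @^-1` C).
  by move=> mC; rewrite -[_ @^-1` _]setTI; exact: measurable_funPT.
pose rect (C : I -> set R) := \bigcap_(j in [set` J]) X j @^-1` C j.
pose G : set (set T) :=
  [set E | exists2 C : I -> set R, forall j, measurable (C j) & E = rect C].
have sG : <<s G >> ((fun w => \sum_(j <- J) X j w)%R @^-1` A).
  apply: sigma_preimage_sum => // j jJ C mC; apply: sub_gen_smallest.
  exists (fun k => if k == j then C else setT); first by move=> k; case: ifP.
  apply/seteqP; split => [w Cw k _|w /(_ j jJ)] /=; last by rewrite eqxx.
  by case: ifPn => // /eqP ->.
have GT : G setT.
  by exists (fun=> setT) => //; rewrite /rect bigcapT.
have mrect C : (forall j, measurable (C j)) -> measurable (rect C).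
  by move=> mC; apply: fin_bigcap_measurable => // j _; exact: mX.
have indep_rect C : (forall j, measurable (C j)) ->
    P (rect C `&` X i @^-1` B) = P (X i @^-1` B) * P (rect C).
  move=> mC; pose C' j := if j == i then B else C j.
  have mC' j : measurable (C' j) by rewrite /C'; case: ifP.
  have C'J j : j \in J -> C' j = C j.
    by move=> jJ; rewrite /C'; case: eqP jJ iNJ => // -> ->.
  have -> : rect C = rect C'.
    by apply: eq_bigcapr => j /= /C'J ->.
  have -> : B = C' i by rewrite /C' eqxx.
  rewrite setIC -(bigcap_fsetU1 (fun j => X j @^-1` C' j)) !indepX ?big_fsetU1//.
  by move=> j jJ; apply: iJD => /=; rewrite in_fsetU jJ orbT.
pose m1 := mrestr P (mX i B mB).
have PB_ge0 : (0 <= fine (P (X i @^-1` B)))%R by exact: fine_ge0.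
pose m2 := mscale (NngNum PB_ge0) P.
have m2E E : m2 E = P (X i @^-1` B) * P E.
  by rewrite /m2 /mscale/= fineK// fin_num_measure//; exact: (mX i B mB).
rewrite [RHS]muleC -m2E.
apply: (g_sigma_algebra_measure_unique G _ (fun=> setT) _ _ m1 m2) sG => //.
- by move=> _ [C mC ->]; exact: mrect.
- by rewrite bigcup_const.
- move=> _ _ [C mC ->] [C' mC' ->]; exists (fun j => C j `&` C' j).
    by move=> j; exact: measurableI.
  by rewrite /rect -bigcapI.
- by move=> _ [C mC ->]; have := indep_rect C mC; rewrite -m2E.
- move=> _; change (P (setT `&` X i @^-1` B) < +oo).
  by rewrite setTI -ge0_fin_numE// fin_num_measure//; exact: (mX i B mB).
Qed.

(** * The random sum *)

(* The sequence is indexed as in xi_1, xi_2, ...; xi 0 is never used. *)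
Theorem theorem4 (d : measure_display) (T : measurableType d) (R : realType)
    (P : probability T R) (xi : nat -> {RV P >-> R}) (eta : {RV P >-> nat})
    (xi_ge0 : forall k : nat, (1 <= k)%N -> forall w : T, (0 <= xi k w)%R)
    (xi_indep : mutually_independent [set k | (1 <= k)%N] xi)
    (eta_counting : counting_rv eta)
    (eta_indep : independent_of_family eta [set k | (1 <= k)%N] xi) :
  (exists2 kappa : nat, (supp eta `\ 0%N) kappa &
    [/\ OL (cdf (xi kappa)),
        forall k : nat, supp eta k -> (1 <= k <= kappa)%N ->
          (tail (cdf (xi k)) x / tail (cdf (xi kappa)) x @[x --> +oo%R] --> 0)
          \/ OL (cdf (xi k)) &
        ereal_sup [set ereal_sup
            [set tail (cdf (xi (kappa + k)%N)) (x - 1)%R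
                 / tail (cdf (xi (kappa + k)%N)) x | k in [set k | (1 <= k)%N]]
          | x in [set x : R | (0 <= x)%R]] < +oo]) ->
  OL (cdf (random_sum xi eta : {RV P >-> R})).
Proof.
move=> [kappa [kappa_supp /= kappa_neq0] [kappaOL _ _]].
have kappa_gt0 : (0 < kappa)%N by rewrite lt0n; exact/eqP.
have [c [c_gt0 ccdf_gt0 ccdf_shift]] := OL_ccdf_shift _ _ _ _ _ kappaOL.
pose S n w := (\sum_(1 <= k < n.+1) xi k w)%R.
pose tS n x := [set w | (x < S n w)%R].
have mS n x : measurable (tS n x).
  have : measurable_fun setT (S n) by exact: measurable_sum.
  move=> /(_ measurableT `]x, +oo[%classic (measurable_itv _)).
  rewrite setTI; congr measurable.
  by apply/seteqP; split => w /=; rewrite in_itv/= andbT.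
have meta n : measurable (eta @^-1` [set n]).
  by rewrite -[_ @^-1` _]setTI; exact: measurable_funPT.
have eta_tS n x : P (eta @^-1` [set n] `&` tS n x) =
    P (eta @^-1` [set n]) * P (tS n x).
  apply: eta_indep => //.
  have -> : tS n x = S n @^-1` `]x, +oo[%classic.
    by apply/seteqP; split => w /=; rewrite in_itv/= andbT.
  apply: sigma_preimage_sum => // k; rewrite mem_index_iota => /andP[k_gt0 _].
  by move=> B mB; apply: sub_gen_smallest; exists k => //; exists B.
have tS_shift n x : (kappa <= n)%N -> P (tS n x) <= c%:E * P (tS n (x + 1)%R).
  move=> kn.
  (* [J] is {1, ..., n} without [kappa], so [S n] splits into [xi kappa] and a sum independent of
     it. *)
  pose J := [fset k in rem kappa (index_iota 1 n.+1)]%fset.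
  have JE k : (k \in J) = (k != kappa) && (0 < k < n.+1)%N.
    by rewrite !inE mem_rem_uniq ?iota_uniq// !inE mem_index_iota.
  have SE w : S n w = (\sum_(k <- J) xi k w + xi kappa w)%R.
    rewrite addrC -(big_fsetU1 _ (fun k => xi k w)) ?JE ?eqxx//.
    apply: perm_big; apply: uniq_perm; rewrite ?iota_uniq ?fset_uniq// => k.
    rewrite mem_index_iota [RHS]in_fset1U JE; case: eqP => [->|//].
    by rewrite kappa_gt0 ltnS kn.
  have mY : measurable_fun setT (fun w => \sum_(k <- J) xi k w)%R.
    exact: measurable_sum.
  pose Y : {RV P >-> R} := HB.pack (fun w => \sum_(k <- J) xi k w)%R
    (isMeasurableFun.Build _ _ _ _ _ mY).
  have tSE y : tS n y = [set w | (y < Y w + xi kappa w)%R].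
    by apply/seteqP; split => w /=; rewrite /tS/= SE.
  rewrite !tSE; apply: indep_add_ccdf_shift => //; first exact: ltW.
  apply: (mutually_independent_sum _ _ _ _ _ _ _ _ _ xi_indep); first by rewrite JE eqxx.
  move=> k /=; rewrite in_fset1U JE => /orP[/eqP ->//|].
  by case/andP => _ /andP[].
pose N : {RV P >-> R} := random_sum xi eta.
have NE x n : eta @^-1` [set n] `&` tS n x `<=` [set w | (x < N w)%R].
  by move=> w [/= <-].
have mN x : measurable [set w | (x < N w)%R].
  have := measurable_funPTI N (measurable_itv `]x, +oo[).
  congr measurable; apply/seteqP; split => w /=; by rewrite in_itv/= andbT.
pose p := fine (P (eta @^-1` [set kappa])).
have pE : P (eta @^-1` [set kappa]) = p%:E by rewrite fineK// fin_num_measure.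
have p_gt0 : (0 < p)%R by rewrite -lte_fin -pE.
have tSkappa x : p%:E * P (tS kappa x) <= ccdf N x.
  by rewrite -pE -eta_tS ccdfE le_measure ?inE//; exact: measurableI.
have S_homo w m n : (m <= n)%N -> (S m w <= S n w)%R.
  move=> mn; rewrite /S [leRHS](big_cat_nat _ (n := m.+1))//= lerDl.
  rewrite big_nat_cond sumr_ge0// => k /andP[/andP[mk _] _].
  by apply: xi_ge0; exact: leq_trans mk.
(* The term [c / p] serves the part covered by [S kappa], and [c] serves the event that
   [eta >= kappa]. *)
apply: (@ccdf_shift_OL _ _ _ _ N (c / p + c)%R).
- by rewrite addr_gt0// divr_gt0.
- move=> x; apply: (lt_le_trans _ (tSkappa x)); rewrite mule_gt0 ?lte_fin//.
  (* By nonnegativity [S kappa] dominates [xi kappa], whose tail is positive. *)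
  apply: (lt_le_trans (ccdf_gt0 x)).
  rewrite ccdfE le_measure ?inE//.
    have := measurable_funPTI (xi kappa) (measurable_itv `]x, +oo[).
    congr measurable; apply/seteqP; split => w /=; by rewrite in_itv/= andbT.
  move=> w /= /lt_le_trans; apply.
  rewrite /S big_nat_recr//= lerDr big_nat_cond sumr_ge0// => k.
  by move=> /andP[/andP[k_gt0 _] _]; exact: xi_ge0.
move=> x.
(* [E y] is the event that [eta >= kappa] and the random sum exceeds [y], cut into disjoint pieces
   on which [eta] is constant, so that tails can be compared term by term. *)
pose E y := \bigcup_(n in [set n | (kappa <= n)%N]) (eta @^-1` [set n] `&` tS n y).
have mEn y n : measurable (eta @^-1` [set n] `&` tS n y) by exact: measurableI.
have mE y : measurable (E y) by exact: bigcup_measurable.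
have trivE y : trivIset [set n | (kappa <= n)%N] (fun n => eta @^-1` [set n] `&` tS n y).
  by move=> m n _ _ [w [[/= <- _] [/= <- _]]].
have E_shift : P (E x) <= c%:E * P (E (x + 1)%R).
  rewrite !measure_bigcup// -nneseriesZl//.
  apply: lee_nneseries => // n; rewrite inE/= => kn.
  rewrite !eta_tS muleCA.
  by apply: lee_wpmul2l => //; exact: tS_shift.
(* Outside [E x], a random sum exceeding [x] has [eta < kappa] and is at most [S kappa]. *)
apply: (@le_trans _ _ (P (tS kappa x) + P (E x))).
  rewrite ccdfE; apply: (@le_trans _ _ (P (tS kappa x `|` E x))); last exact: measureU2.
  apply: le_measure; rewrite ?inE//; first exact: measurableU.
  move=> w /= xN; have [kn|/ltnW nk] := leqP kappa (eta w).
    by right; exists (eta w).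
  by left; apply: (lt_le_trans xN); exact: S_homo.
rewrite EFinD ge0_muleDl; last 2 first.
- by rewrite lee_fin ltW// divr_gt0.
- by rewrite lee_fin ltW.
apply: leeD.
  apply: (le_trans (tS_shift kappa x (leqnn _))).
  by rewrite EFinM -muleA lee_pmul2l// lee_pdivlMl.
apply: (le_trans E_shift); rewrite lee_pmul2l// ccdfE le_measure ?inE//.
by move=> w [n _ /NE].
Qed.
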